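(* Every strong semicomplete composition $Q=T[H_1,\dots,H_t]$ with at least six vertices has at least five 4-kings. Furthermore, if such a $Q$ has no 3-king, then it has at least eight 4-kings.
   Context: All digraphs are finite, without loops or parallel arcs; paths are directed. Let $T$ be a digraph with vertices $u_1,\dots,u_t$ ($t\ge 2$) and $H_1,\dots,H_t$ digraphs, $H_i$ having vertices $u_{i,j}$, $1\le j\le n_i$. The composition $Q=T[H_1,\dots,H_t]$ has vertex set $\{u_{i,j}\}$ and arc set $\bigcup_i A(H_i)\cup\{u_{i,j}u_{p,q}: u_iu_p\in A(T)\}$ (all $j,q$). It is a semicomplete composition if $T$ is semicomplete (at least one arc between every two distinct vertices). A digraph is strong if every vertex can reach every other vertex. For $k\ge 2$, a $k$-king is a vertex from which every other vertex can be reached by a directed path of length at most $k$. *)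

(* Defs.v *)
From mathcomp Require Import all_boot.

Set Implicit Arguments.
Unset Strict Implicit.
Unset Printing Implicit Defensive.

(* [arc] is a relation, so parallel arcs are excluded; 2-cycles are allowed. *)
Record digraph := Digraph {
  vertex :> finType;
  arc : rel vertex;
  arc_irr : irreflexive arc
}.

Section Composition.

Variables (T : digraph) (H : T -> digraph).

(* [tagged_as x y] is [tagged y] seen as a vertex of [H (tag x)]; it is only
   meaningful when [tag y = tag x], which the conjunction guarantees. *)
Definition comp_arc : rel {i : T & H i} := fun x y =>
  arc (tag x) (tag y)
  || (tag y == tag x) && arc (tagged x) (tagged_as x y).

Lemma comp_arc_irr : irreflexive comp_arc.
Proof. by case=> i u; rewrite /comp_arc tagged_asE !arc_irr andbF. Qed.

Definition composition : digraph := Digraph comp_arc_irr.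

End Composition.

Definition semicomplete (D : digraph) : Prop :=
  forall x y : D, x != y -> arc x y || arc y x.

Definition strong (D : digraph) : Prop :=
  forall x y : D, connect (@arc D) x y.

(* [x :: p] is a directed path from [x]; its length is [size p], which the
   type [{bseq k of D}] bounds by [k]. *)
Definition king (k : nat) (D : digraph) (x : D) : bool :=
  [forall y : D, (y != x) ==>
    [exists p : {bseq k of D},
      [&& path (@arc D) x p, uniq (x :: p) & last x p == y]]].

Definition kings (k : nat) (D : digraph) : {set D} := [set x | king k x].

(* Main.v *)
From mathcomp Require Import all_boot.
(* Imported last, as [path] also defines an [arc]. *)
Require Import Defs.

(* For [k >= 3] every vertex of [Q] lying over a [k]-king of [T] is a [k]-king
   of [Q], because every vertex of [T] lies on a closed walk of length at most 3.
   In [T] the in-neighbourhood of any vertex contains a 2-king. In particular [Q]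
   has a 3-king, so the second claim is vacuous. Let [K] be the set of 2-kings of
   [T]; then [#|K| >= 2], and every vertex at distance at most 2 to [K] is a
   4-king. If some vertex is farther away, the vertices at distance 1 and 2 to [K]
   provide two more 4-kings. Should there be four in total, say [K] and [x], [y]
   at distances 1 and 2, then [x] dominates all farther vertices, one of these
   dominates [y], and the two elements of [K] dominate each other; so [x] would
   itself be a 2-king, a contradiction. *)

Set Implicit Arguments.
Unset Strict Implicit.
Unset Printing Implicit Defensive.

(** * Bounded walks, kings, and cuts in a strong digraph *)

Section Reach.

Variable D : digraph.
Implicit Types (x y z : D) (k : nat) (S : {set D}).

(** Vertices may repeat, so walks extend freely; [kingP] shortens them to the paths that [king] asks
    for. *)
Definition reach k x y : Prop :=
  exists p, [/\ path (@arc D) x p, last x p = y & size p <= k].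

Lemma reach0 k x : reach k x x.
Proof. by exists [::]. Qed.

Lemma reach_step k x y z : arc x y -> reach k y z -> reach k.+1 x z.
Proof. by move=> xy [p [yp pz sp]]; exists (y :: p); split; rewrite //= xy. Qed.

Lemma reach_arc k x y : arc x y -> reach k.+1 x y.
Proof. by move=> xy; apply: reach_step xy (reach0 k y). Qed.

Lemma reach_rcons k x y z : reach k x y -> arc y z -> reach k.+1 x z.
Proof.
move=> [p [xp py sp]] yz; exists (rcons p z).
by rewrite rcons_path last_rcons size_rcons py xp.
Qed.

Lemma reach_leq k k' x y : k <= k' -> reach k x y -> reach k' x y.
Proof. by move=> kk' [p [xp py sp]]; exists p; split=> //; apply: leq_trans kk'. Qed.

Lemma kingP k x : reflect (forall y, reach k x y) (king k x).
Proof.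
apply: (iffP forallP) => [kx y | rx y].
  have [->|/(implyP (kx y))/existsP[p /and3P[xp _ /eqP py]]] := eqVneq y x.
    exact: reach0.
  by exists p; split=> //; apply: size_bseq.
apply/implyP => _; apply/existsP; have [p [xp <- sp]] := rx y.
case: (shortenP xp) => q xq uq qp.
have sq : size q <= k.
  by apply: leq_trans sp; apply: uniq_leq_size => //; case/andP: uq.
by exists (Bseq sq); apply/and3P; split.
Qed.

Lemma king_leq k k' x : k <= k' -> king k x -> king k' x.
Proof. by move=> kk' /kingP kx; apply/kingP => y; apply: reach_leq (kx y). Qed.

Lemma king_arc k x y : arc x y -> king k y -> king k.+1 x.
Proof. by move=> xy /kingP ky; apply/kingP => z; apply: reach_step (ky z). Qed.

Definition in_closure S := S :|: [set x | [exists y in S, arc x y]].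

Lemma in_closureP S x :
  reflect (x \in S \/ exists2 y, y \in S & arc x y) (x \in in_closure S).
Proof.
rewrite !inE; apply: (iffP orP) => [[|/existsP[y /andP[]]]|[|[y yS xy]]].
- by left.
- by right; exists y.
- by left.
- by right; apply/existsP; exists y; rewrite yS.
Qed.

Lemma in_closureN S x y : x \notin in_closure S -> y \in S -> ~~ arc x y.
Proof. by move=> xS yS; apply: contra xS => xy; apply/in_closureP; right; exists y. Qed.

Hypothesis sD : strong D.

Lemma strong_cut S x y : x \notin S -> y \in S ->
  exists z w, [/\ z \notin S, w \in S & arc z w].
Proof.
move=> xS yS; have /connectP[p xp ey] := sD x y.
elim: p x xS xp ey => [|z p IHp] x xS /=; first by move=> _ ey; rewrite -ey yS in xS.
case/andP=> xz zp ey; have [zS|zS] := boolP (z \in S); last exact: IHp zS zp ey.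
by exists x, z.
Qed.

Lemma in_closure_proper S x y : x \notin S -> y \in S -> S \proper in_closure S.
Proof.
move=> xS yS; have [z [w [zS wS zw]]] := strong_cut xS yS.
apply/properP; split; first exact: subsetUl.
by exists z => //; apply/in_closureP; right; exists w.
Qed.

End Reach.

(** * Kings of a strong semicomplete digraph *)

Section SemicompleteKings.

Variable D : digraph.
Hypotheses (D_semi : semicomplete D) (D_strong : strong D) (D_gt1 : 1 < #|D|).
Implicit Types x y z : D.

Lemma semi_arcN x y : x != y -> ~~ arc x y -> arc y x.
Proof. by move=> /D_semi/orP[->|]. Qed.

Lemma neq_exists x : exists y, y != x.
Proof.
apply/existsP; apply: contraTT D_gt1; rewrite negb_exists -leqNgt => /forallP allx.
by apply/card_le1_eqP => y z _ _;
  rewrite (eqP (negbNE (allx y))) (eqP (negbNE (allx z))).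
Qed.

Lemma in_neighbour x : exists y, arc y x.
Proof.
have [y yx] := neq_exists x.
have [|z [w [_ /set1P-> zx]]] := @strong_cut D D_strong [set x] y x _ (set11 x).
  by rewrite inE.
by exists z.
Qed.

Lemma out_neighbour x : exists y, arc x y.
Proof.
have [y yx] := neq_exists x.
have [||z [w [zx _ zw]]] := @strong_cut D D_strong (~: [set x]) x y.
- by rewrite !inE eqxx.
- by rewrite !inE.
by exists w; move: zx; rewrite !inE negbK => /eqP <-.
Qed.

(* A vertex dominating the most in-neighbours of [x] reaches the out-neighbours
   of [x] through [x]. *)
Lemma in_neighbour_king x : exists2 y, arc y x & king 2 y.
Proof.
have [y0 y0x] := in_neighbour x.
pose out y := [set z | arc z x && arc y z].
case: (@arg_maxnP _ y0 (fun y => arc y x) (fun y => #|out y|) y0x) => y yx ymax.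
exists y => //; apply/kingP => z.
have [->|zy] := eqVneq z y; first exact: reach0.
have [->|zx] := eqVneq z x; first exact: reach_arc.
have [azx|/(semi_arcN zx) xz] := boolP (arc z x); last first.
  exact: reach_step yx (reach_arc _ xz).
have [yz|yz] := boolP (arc y z); first exact: reach_arc.
have azy : arc z y by apply: semi_arcN yz; rewrite eq_sym.
have [/existsP[w /andP[yw wz]]|noz] := boolP [exists w, arc y w && arc w z].
  exact: reach_step yw (reach_arc _ wz).
(* With no path of length 2 from [y] to [z], [z] dominates all of [out y] and also [y], against the
   maximality of [y]. *)
suff /proper_card : out y \proper out z by rewrite ltnNge => /negP[]; apply: ymax.
apply/properP; split; last by exists y; rewrite !inE ?yx // arc_irr.
apply/subsetP => w; rewrite !inE => /andP[-> yw] /=.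
apply: semi_arcN; first by apply: contraNneq yz => <-.
by apply: contra noz => wz; apply/existsP; exists w; rewrite yw.
Qed.

(** An arc leaving the out-neighbourhood of [x] ends in [x] itself or in a vertex that dominates
    [x]. *)
Lemma short_return x : exists2 y, arc x y & reach 2 y x.
Proof.
have [y0 xy0] := out_neighbour x.
have [||y [z [yS zS yz]]] := @strong_cut D D_strong [set y | ~~ arc x y] y0 x.
- by rewrite inE negbK.
- by rewrite inE arc_irr.
move: yS zS; rewrite !inE negbK => xy xz; exists y => //.
have [zx|zx] := eqVneq z x; first by rewrite -zx; apply: reach_arc.
by apply: reach_step yz (reach_arc _ _); apply: semi_arcN xz; rewrite eq_sym.
Qed.

(** The first alternative absorbs digraphs with fewer than five vertices. *)
Lemma kings4_semicomplete : kings 4 D = setT \/ 5 <= #|kings 4 D|.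
Proof.
pose K := kings 2 D; pose K1 := in_closure K; pose K2 := in_closure K1.
have K2_king x : x \in K2 -> king 4 x.
  suff K1_king y : y \in K1 -> king 3 y.
    case/in_closureP=> [/K1_king|[y /K1_king ky xy]]; first exact: king_leq.
    exact: king_arc xy ky.
  case/in_closureP=> [|[z]]; rewrite inE; first exact: king_leq.
  by move=> kz yz; apply: king_arc yz kz.
have [fullK2|/subsetPn[v _ vK2]] := boolP ([set: D] \subset K2).
  by left; apply/setP => x; rewrite !inE K2_king // (subsetP fullK2) ?inE.
right; suff c2 : 4 < #|K2|.
  by apply: leq_trans c2 (subset_leq_card _); apply/subsetP => x /K2_king; rewrite inE.
have K_in x : exists2 y, y \in K & arc y x.
  by have [y yx ky] := in_neighbour_king x; exists y; rewrite ?inE.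
have [a aK _] := K_in v; have [b bK ba] := K_in a.
have vK1 : v \notin K1 by apply: contra vK2 => vK1; apply/in_closureP; left.
have vK : v \notin K by apply: contra vK1 => vK; apply/in_closureP; left.
have aK1 : a \in K1 by apply/in_closureP; left.
have aK2 : a \in K2 by apply/in_closureP; left.
have pK : K \proper K1 := in_closure_proper D_strong vK aK.
have pK1 : K1 \proper K2 := in_closure_proper D_strong vK1 aK1.
(* As both inclusions are proper, at most four vertices in [K2] force sizes 2 and 3 for [K] and
   [K1], so each further layer has at most one vertex. *)
rewrite ltnNge; apply/negP => c2.
have c1 : #|K1| <= 3 by rewrite -ltnS; apply: leq_trans (proper_card pK1) c2.
have c0 : #|K| <= 2 by rewrite -ltnS; apply: leq_trans (proper_card pK) c1.
have ab : a != b by apply: contraTneq ba => ->; rewrite arc_irr.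
have EK : K = [set a; b].
  apply/esym/eqP; rewrite eqEcard subUset !sub1set aK bK.
  by rewrite cards2 ab.
have cK : #|K| = 2 by rewrite EK cards2 ab.
have cK1 : #|K1| = 3 by apply/eqP; rewrite eqn_leq c1 -cK proper_card.
have d1 : #|K1 :\: K| <= 1.
  by rewrite cardsD (setIidPr (proper_sub pK)) cK cK1.
have d2 : #|K2 :\: K1| <= 1.
  by rewrite cardsD (setIidPr (proper_sub pK1)) cK1 leq_subLR.
(* An element of [K] has an in-neighbour in [K], which can only be the other element. *)
have arcK : {in K &, forall y z, y != z -> arc y z}.
  move=> y z yK zK yz; have [w wK wz] := K_in z.
  have wz' : w != z by apply: contraTneq wz => ->; rewrite arc_irr.
  suff -> : y = w by [].
  move: yK zK wK yz wz'; rewrite EK !inE.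
  by do 3! [case/orP => /eqP->]; rewrite ?eqxx.
have [x [k [xK kK xk]]] := strong_cut D_strong vK aK.
have xK1 : x \in K1 by apply/in_closureP; right; exists k.
have [w [y [wK2 yK2 wy]]] := strong_cut D_strong vK2 aK2.
have xout z : z \notin K2 -> arc x z.
  move=> zK2; apply: semi_arcN (in_closureN zK2 xK1).
  by apply: contraNneq zK2 => ->; apply/in_closureP; left.
case/negP: (xK); rewrite inE; apply/kingP => z.
have [zK2|/xout xz] := boolP (z \in K2); last exact: reach_arc.
have [zK1|zK1] := boolP (z \in K1); last first.
  (* An in-neighbour of [K1] would lie in [K2], but [w] does not; so [y] is the only vertex of the
     outer layer. *)
  have yK1 : y \notin K1 by apply: contraTN wy => /(in_closureN wK2).
  have -> : z = y by apply: (card_le1_eqP d2); rewrite inE ?zK1 ?yK1.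
  exact: reach_step (xout _ wK2) (reach_arc _ wy).
have [zK|zK] := boolP (z \in K); last first.
  have -> : z = x; last exact: reach0.
  by apply: (card_le1_eqP d1); rewrite inE ?zK ?xK ?xK1 ?zK1.
have [<-|kz] := eqVneq k z; first exact: reach_arc.
exact: reach_step xk (reach_arc _ (arcK _ _ kK zK kz)).
Qed.

End SemicompleteKings.

(** * Passing between [T] and the composition *)

Section Lifting.

Variables (T : digraph) (H : T -> digraph).
Hypothesis (H_gt0 : forall i : T, 0 < #|H i|).
Local Notation Q := (composition H).

Lemma fibre_inhabited (i : T) : exists x : Q, tag x = i.
Proof. by have /card_gt0P[u _] := H_gt0 i; exists (Tagged (fun j => vertex (H j)) u). Qed.

Lemma comp_arc_tag (x y : Q) : arc (tag x) (tag y) -> arc x y.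
Proof. by move=> xy; apply/orP; left. Qed.

Lemma strong_base : strong Q -> strong T.
Proof.
move=> sQ i j; have [[x <-] [y <-]] := (fibre_inhabited i, fibre_inhabited j).
have /connectP[p xp ->] := sQ x y.
elim: p x xp => [|z p IHp] x /=; first by move=> _; apply: connect0.
case/andP=> xz /IHp; apply: connect_trans.
by have [/connect1|/andP[/eqP-> _]] := orP xz.
Qed.

(** Intermediate vertices are arbitrary in their fibres, and the first visit to the fibre of [y] is
    sent to [y]. Distinct tags exclude the empty walk, which need not lift. *)
Lemma reach_lift k (x y : Q) :
  tag x != tag y -> reach k (tag x) (tag y) -> reach k x y.
Proof.
move=> + [p [xp py]]; elim: p x k xp py => [|i p IHp] x k /=.
  by move=> _ ->; rewrite eqxx.
case/andP=> xi ip py nxy; case: k => // k sp.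
have [iy|iy] := eqVneq i (tag y).
  by apply/reach_arc/comp_arc_tag; rewrite -iy.
have [z ez] := fibre_inhabited i; rewrite -ez in xi ip py iy.
exact: reach_step (comp_arc_tag xi) (IHp z k ip py iy sp).
Qed.

Hypotheses (T_semi : semicomplete T) (T_strong : strong T) (T_gt1 : 1 < #|T|).

Lemma king_lift k (x : Q) : 2 < k -> king k (tag x) -> king k x.
Proof.
move=> k3 /kingP kx; apply/kingP => y.
have [xy|xy] := eqVneq (tag x) (tag y); last exact: reach_lift.
(* Within a fibre, [y] is reached by leaving and coming back; the first arc is split off so that the
   rest joins distinct tags. *)
have [i xi ix] := short_return T_semi T_strong T_gt1 (tag x).
have [z ez] := fibre_inhabited i; rewrite -ez in xi ix.
apply: reach_leq k3 _; apply: reach_step (comp_arc_tag xi) _.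
by apply: reach_lift; rewrite -xy //; apply: contraTneq xi => ->; rewrite arc_irr.
Qed.

End Lifting.

Theorem theorem2p15 (T : digraph) (H : T -> digraph)
  (ht : 2 <= #|T|)
  (hH : forall i : T, 0 < #|H i|)
  (hT : semicomplete T)
  (hQ : strong (composition H))
  (h6 : 6 <= #|composition H|) :
  5 <= #|kings 4 (composition H)| /\
  ((~ exists x : composition H, king 3 x) ->
   8 <= #|kings 4 (composition H)|).
Proof.
have sT := strong_base hH hQ.
have lift := king_lift hH hT sT ht.
split; last first.
  have /card_gt0P[i0 _] := ltnW ht.
  have [i _ ki] := in_neighbour_king hT sT ht i0.
  have [x ex] := fibre_inhabited hH i.
  by case; exists x; apply: lift => //; apply: king_leq (_ : king 2 _); rewrite ?ex.
have [K4|] := kings4_semicomplete hT sT ht.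
  suff -> : kings 4 (composition H) = setT by rewrite cardsT; apply: ltnW.
  by apply/setP => x; rewrite !inE lift //; have := in_setT (tag x); rewrite -K4 inE.
move/leq_trans; apply.
(* The tags of the 4-kings of the composition include all 4-kings of [T]. *)
apply: leq_trans (leq_imset_card (fun x : composition H => tag x) _).
apply/subset_leq_card/subsetP => i; rewrite inE => ki.
have [x ex] := fibre_inhabited hH i; apply/imsetP; exists x => //.
by rewrite inE lift ?ex.
Qed.
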